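(* Let $n\ge 1$ be an integer and let $g(0),g(1),\dots,g(n)$ be complex numbers with $g(0)\ne 0$. Then there always exist numbers $\mu\in\mathbb{C}$, $\mu\ne 0$, and $\Lambda_n=\{\lambda_k\}_{k=1}^n$, $\lambda_k\in\mathbb{C}\cup\{-\infty\}$, uniquely determined (up to the period $2\pi i$ of the complex exponential in each $\lambda_k$, and up to ordering of the $\lambda_k$), such that $$\frac{\mu}{n}\sum_{k=1}^n\exp(\lambda_km)=g(m),\qquad m=0,\dots,n.$$ More precisely, the numbers are determined by $$\mu=g(0)\qquad\text{and}\qquad\exp(\lambda_k)=l_k,\quad k=1,\dots,n,$$ where $l_1,\dots,l_n\in\mathbb{C}$ are the solution of the system $$\sum_{k=1}^n l_k^m=\frac{n}{g(0)}\,g(m),\qquad m=1,\dots,n.$$ Additionally: (a) if $n\ge 2$ and $|g(m)|\le\frac{|g(0)|}{n}a^m$ for some $a\ge 0$ and all $m=1,\dots,n$, then $$\max_{k=1,\dots,n}|l_k|\le(1+\varepsilon_n)a,\quad\text{and consequently}\quad -\infty\le\operatorname{Re}\lambda_k\le\ln a+\varepsilon_n,\quad k=1,\dots,n;$$ (b) if $|g(m)|\le\frac{|g(0)|}{n}\gamma m a^m$ for some $\gamma>0$ and $a\ge 0$ and all $m=1,\dots,n$, then $$\max_{k=1,\dots,n}|l_k|\le(1+2\gamma)a,\quad\text{and consequently}\quad -\infty\le\operatorname{Re}\lambda_k\le\ln a+\ln(1+2\gamma),\quad k=1,\dots,n.$$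
   Context: For $n\ge 2$, $\varepsilon_n:=\frac{2(\ln n-\ln\ln n)}{n}$. The value $\lambda_k=-\infty$ corresponds to $l_k=0$, with the conventions $\exp(\lambda_k m)=0$ for $m\ge 1$, $\exp(\lambda_k\cdot 0)=1$ and $\operatorname{Re}\lambda_k=-\infty$ in this case; also $\ln 0=-\infty$. The families $\{\lambda_k\}$ and $\{l_k\}$ are unordered, with repetitions allowed. *)

(* Defs.v *)
From HB Require Import structures.
From mathcomp Require Import all_boot all_order all_algebra all_fingroup.
From mathcomp Require Import all_classical all_reals all_analysis.
From mathcomp Require Import complex.

Set Implicit Arguments.
Unset Strict Implicit.
Unset Printing Implicit Defensive.
Import Order.TTheory GRing.Theory Num.Theory.

Local Open Scope ring_scope.
Local Open Scope complex_scope.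

Notation cabs := ComplexField.Normc.normc.

Definition cexp (R : realType) (z : R[i]) : R[i] :=
  let: x +i* y := z in (expR x * cos y) +i* (expR x * sin y).

(* C together with -oo, the latter encoded as [None]. *)
Definition xcomplex (R : realType) : Type := option R[i].

(* exp(lambda), with exp(-oo) = 0. *)
Definition xexp (R : realType) (lam : xcomplex R) : R[i] :=
  if lam is Some z then cexp z else 0.

(* exp(lambda m); for lambda = -oo this is 1 if m = 0 and 0 if m >= 1. *)
Definition xexpM (R : realType) (lam : xcomplex R) (m : nat) : R[i] :=
  if lam is Some z then cexp (z * m%:R) else (m == 0)%:R.

Definition xRe (R : realType) (lam : xcomplex R) : \bar R :=
  if lam is Some z then (complex.Re z)%:E else -oo%E.

Definition eq_mod_2pii (R : realType) (lam lam' : xcomplex R) : Prop :=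
  match lam, lam' with
  | Some z, Some w => exists j : int, z = w + (0 +i* (2 * pi)) * j%:~R
  | None, None => True
  | _, _ => False
  end.

(* Families indexed by ['I_n] are compared as unordered families by allowing a
   permutation of the indices. *)
Definition exp_sum_system (R : realType) (n : nat) (g : nat -> R[i])
    (mu : R[i]) (Lam : 'I_n -> xcomplex R) : Prop :=
  forall m : nat, (m <= n)%N ->
    mu / n%:R * (\sum_(k < n) xexpM (Lam k) m) = g m.

Definition power_sum_system (R : realType) (n : nat) (g : nat -> R[i])
    (l : 'I_n -> R[i]) : Prop :=
  forall m : nat, (1 <= m <= n)%N ->
    \sum_(k < n) l k ^+ m = n%:R / g 0%N * g m.

Definition epsilon (R : realType) (n : nat) : R :=
  2 * (ln n%:R - ln (ln n%:R)) / n%:R.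

(* Main.v *)
Require Import Defs.
From mathcomp Require Import all_boot all_order all_algebra all_fingroup.
From mathcomp Require Import all_classical all_reals all_analysis.
From mathcomp Require Import complex.
From mathcomp Require Import ring lra zify.
Import Order.TTheory GRing.Theory Num.Theory.
Local Open Scope ring_scope.
Local Open Scope complex_scope.

(** Let [s m] be the power sums of a family [x_1, ..., x_n] and let [c m] be the
coefficients of [\prod_k (1 - x_k X)].  Newton's identities
[m c_m = - (s_1 c_(m-1) + ... + s_m c_0)] say that the power sums
[s_1, ..., s_n] and the coefficients [c_1, ..., c_n] determine each other.
Over an algebraically closed field of characteristic zero, every prescription
of the first [n] power sums is thus realised by exactly one family of [n]
numbers up to ordering, the roots of [\sum_m c_m X^(n-m)]
([power_sums_exist], [power_sums_unique]).  With [l_k = exp(lambda_k)], the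
interpolation problem at [m = 0] says that [mu = g 0] and at [1 <= m <= n] that
the [l_k] have the prescribed power sums ([exp_sum_systemP]); the exponential
is onto the nonzero numbers and has period [2 pi i], and [l_k = 0] is covered
by [lambda_k = -oo].

For the two estimates, assume that some [l_k] violates the bound and divide the
family by it.  The new family contains [1], so [\sum_(m <= n) c_m = 0], while
its power sums are small; here [t] denotes [1 / (1 + 2 gamma)] or
[1 / (1 + epsilon_n)].

(b) From [|s_m| <= gamma m t^m] and Newton's identities,
[|c_m| <= gamma (1 + gamma)^(m-1) t^m].  The sum of these bounds over
[1 <= m <= n] is [1 - ((1 + gamma) t)^n < 1 = c_0], which contradicts
[\sum_(m <= n) c_m = 0] ([power_sums_linear_contra]).

(a) The same argument would only give the constant [2].  Instead, replace [s_m]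
by [0] for [m > n], and let [c] and [e], now defined for all [m], be the
coefficients of [exp(- \sum_m s_m X^m / m)] and of its inverse.  If
[|s_m| <= t^m], then [|c_m| <= t^m], [|e_m| <= t^m] and [|c_m| <= (n / m) t^m]
for [m > n].  The first [n + 1] terms of [\sum_m c_m] add up to [0], and the
product of [\sum_m c_m] and [\sum_m e_m] is [1]; hence
[1 <= (\sum_(m > n) (n / m) t^m) / (1 - t)].  With [t = 1 / (1 + d)] this is
impossible if [1 <= 2 d n] and [n < (1 + d)^(n-1) d ((n + 1) d + 1/2)]
([power_sums_geometric_contra]).

That [d = epsilon_n] satisfies the last inequality ([gap_epsilon]) is proved
with [w = ln n - ln (ln n)], so that [epsilon_n = 2 w / n] and [exp w = n / ln n].
For [n >= 42] the power [(1 + d)^(n-1)] is estimated through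
[2 d / (2 + d) <= ln (1 + d)]; for [5 <= n <= 41] a rational lower bound of
[epsilon_n] suffices for each [n]; for [n <= 4] the bound [w >= 1] does. *)

Set Implicit Arguments.
Unset Strict Implicit.
Unset Printing Implicit Defensive.

(** * Bounds of the exponential and of the logarithm *)

(** A sharp enough lower bound of the logarithm: the difference of the two sides
has derivative [x^2 / ((1 + x) (2 + x)^2)]. *)
Lemma pade_le_ln1D (R : realType) (x : R) :
  0 <= x -> 2 * x / (2 + x) <= ln (1 + x).
Proof.
move=> x0.
(* [2 x / (2 + x) = 2 - 4 / (2 + x)], which is easier to differentiate. *)
pose f (y : R) := ln (1 + y) + 4 * (2 + y)^-1.
have df (y : R) : 0 <= y -> is_derive y 1 f ((1 + y)^-1 - 4 * (2 + y) ^- 2).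
  move=> y0.
  have y1 : 0 < 1 + y by lra.
  have y2 : 2 + y != 0 by apply: lt0r_neq0; lra.
  have d1 (c : R) : is_derive y 1 (fun z : R => c + z) 1.
    by have := is_deriveD (is_derive_cst c y 1) (is_derive_id y 1); rewrite add0r.
  have dln := is_derive1_comp (is_derive1_ln y1) (d1 1).
  have dV := is_deriveV y2 (d1 2).
  have dMV : is_derive y 1 (fun z : R => 4 * (2 + z)^-1) (4 * - (2 + y) ^- 2).
    have := is_deriveZ 4 dV; rewrite /GRing.scale/= mulr1; exact.
  have := is_deriveD dln dMV; rewrite mulr1 mulrN; exact.
suff : f 0 <= f x.
  rewrite /f !addr0 ln1 add0r => h.
  have -> : 2 * x / (2 + x) = 2 - 4 * (2 + x)^-1 by field; lra.
  by lra.
have cf : ({within `[0%R, +oo[, continuous f})%classic.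
  apply: derivable_within_continuous => y; rewrite in_itv/= andbT => /df ?.
  exact: ex_derive.
apply: (ger0_derive1_ndecry _ _ cf) => // y; rewrite in_itv/= andbT => /ltW y0.
- have ? := df _ y0; exact: ex_derive.
- have ? := df _ y0; rewrite derive1E derive_val.
  have -> : (1 + y)^-1 - 4 * (2 + y) ^- 2 = y ^+ 2 / ((1 + y) * (2 + y) ^+ 2).
    by field; apply/andP; split; lra.
  by rewrite divr_ge0 ?mulr_ge0 ?exprn_ge0 //; lra.
Qed.

Lemma expR_ge_quadratic (R : realType) (x : R) :
  0 <= x -> 1 + x + x ^+ 2 / 2 <= expR x.
Proof.
move=> x0.
have nd : {homo series (exp_coeff x) : m n / (m <= n)%N >-> m <= n}.
  apply/nondecreasing_seqP => n; rewrite -subr_ge0.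
  by rewrite seriesSB divr_ge0 ?exprn_ge0.
have := nondecreasing_cvgn_le nd (is_cvg_series_exp_coeff x) 3%N.
apply: le_trans.
by rewrite /series/= !big_nat_recr//= big_nil /exp_coeff/= add0r expr0 expr1 !divr1.
Qed.

(** * The inequality satisfied by [epsilon] *)

(** The inequality in [d] under which a family of [n] numbers whose power sums
satisfy [|s_m| <= (1 + d)^(-m)] for [1 <= m <= n] cannot contain [1], provided
that [1 <= 2 d n]. *)
Definition gap (R : realFieldType) (n : nat) (d : R) : Prop :=
  n%:R < (1 + d) ^+ n.-1 * (d * (n.+1%:R * d + 1 / 2)).

Lemma gap_mono (R : realFieldType) (n : nat) (d d' : R) :
  0 <= d -> d <= d' -> gap n d -> gap n d'.
Proof.
move=> d0 dd' /lt_le_trans; apply.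
apply: ler_pM; rewrite ?exprn_ge0 ?mulr_ge0 ?addr_ge0 ?mulr_ge0//; try lra.
  by apply: lerXn2r; rewrite ?nnegrE; lra.
apply: ler_pM; rewrite ?addr_ge0 ?mulr_ge0//; try lra.
by rewrite lerD2r ler_wpM2l.
Qed.

(** The tangent of the logarithm at [expR s], for any upper bound [c] of its
slope. *)
Lemma sub_ln_ge (R : realType) (s c x : R) : (expR s)^-1 <= c -> 0 < x ->
  (1 - c) * x + (1 - s) <= x - ln x.
Proof.
move=> sc x0.
have es := expR_gt0 s.
have y0 : 0 < x / expR s by rewrite divr_gt0.
have : ln (1 + (x / expR s - 1)) <= x / expR s - 1 by apply: le_ln1Dx; lra.
rewrite addrC subrK ln_div ?posrE// expRK => h.
have : x / expR s <= x * c by rewrite ler_pM2l.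
by lra.
Qed.

Lemma ln_natS_ge (R : realType) (k : nat) : (0 < k)%N ->
  ln (k%:R : R) + 2 / (2 * k%:R + 1) <= ln k.+1%:R.
Proof.
move=> k0; have k0' : 0 < k%:R :> R by rewrite ltr0n.
have -> : k.+1%:R = k%:R * (1 + k%:R^-1) :> R.
  by rewrite -natr1; field; lra.
rewrite lnM ?posrE ?addr_gt0 ?invr_gt0// lerD2l.
have -> : 2 / (2 * k%:R + 1) = 2 * k%:R^-1 / (2 + k%:R^-1) :> R.
  by field; apply/andP; split; lra.
by apply: pade_le_ln1D; rewrite invr_ge0 ltW.
Qed.

Lemma gap_epsilon_of_le (R : realType) (n : nat) (q x : R) : (2 <= n)%N -> 0 <= q ->
  x <= ln n%:R - ln (ln n%:R) -> q * n%:R <= 2 * x -> gap n q ->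
  gap n (epsilon R n).
Proof.
move=> n2 q0 xw qx; apply: gap_mono => //.
have n0 : 0 < n%:R :> R by rewrite ltr0n; lia.
by rewrite /epsilon ler_pdivlMr//; lra.
Qed.

(** One step of the verification of [gap n (epsilon R n)] for [k <= n <= N]: the
lower bound [l] of [ln k] yields the lower bound [q] of [epsilon R k], and then
the lower bound [l'] of [ln (k + 1)]. *)
Lemma gap_epsilon_step (R : realType) (a b l q l' : R) (k N : nat) :
  (forall x, 0 < x -> a * x + b <= x - ln x) -> 0 <= a -> (2 <= k)%N ->
  l <= ln k%:R -> 0 <= q -> q * k%:R <= 2 * (a * l + b) -> gap k q ->
  (l' - l) * (2 * k%:R + 1) <= 2 ->
  (l' <= ln k.+1%:R ->
    forall n, (k < n <= N)%N -> gap n (epsilon R n)) ->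
  forall n, (k <= n <= N)%N -> gap n (epsilon R n).
Proof.
move=> H a0 k2 lk q0 qk gk ll' IH n /andP[]; rewrite leq_eqVlt => /predU1P[<- _|kn nN].
  apply: (gap_epsilon_of_le k2 q0 _ qk gk).
  have : a * l <= a * ln k%:R by rewrite ler_wpM2l.
  have : 0 < ln k%:R :> R by rewrite ln_gt0// ltr1n.
  by move=> /H; lra.
apply: IH; last by rewrite kn.
have : l' - l <= 2 / (2 * k%:R + 1).
  by rewrite ler_pdivlMr// ltr_pwDr// mulr_ge0.
by have := ln_natS_ge R (ltnW k2); lra.
Qed.

(* [row H q l'] performs [gap_epsilon_step] on the current goal: [H] is the lower
bound of [x - ln x] to use and the bound of [ln k] is found in the context,
where the bound [l'] of [ln (k + 1)] replaces it. *)
Ltac row H q' l1 :=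
  refine (@gap_epsilon_step _ _ _ _ q' l1 _ _ H _ _ _ _ _ _ _ _);
  [clear; lra | by [] | eassumption | clear; lra | clear; lra
  | clear; rewrite /gap [_.-1]/=; lra | clear; lra |];
  match goal with H : is_true (_ <= ln _) |- _ => clear H end; intro.

Lemma inv_expR_le (R : realType) (x c : R) (k : nat) : 0 <= x -> 0 <= c ->
  1 <= c * (1 + x + x ^+ 2 / 2) ^+ k -> (expR (k%:R * x))^-1 <= c.
Proof.
move=> x0 c0 h.
rewrite -[_^-1]mul1r ler_pdivrMr ?expR_gt0// expRM_natl.
apply: (le_trans h); rewrite ler_wpM2l// lerXn2r ?nnegrE ?expR_ge0//.
  by rewrite !addr_ge0 ?divr_ge0 ?exprn_ge0.
exact: expR_ge_quadratic.
Qed.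

(** [sub_ln_ge] at [s = 903 / 1000], accurate for [x] around [2.5]. *)
Lemma sub_ln_ge_small (R : realType) (x : R) :
  0 < x -> (59 / 100) * x + 97 / 1000 <= x - ln x.
Proof.
have h : (expR (3%:R * (301 / 1000)))^-1 <= 41 / 100 :> R.
  by apply: inv_expR_le; clear; lra.
move=> /(sub_ln_ge h); clear; lra.
Qed.

(** [sub_ln_ge] at [s = 1], accurate for [x] around [2.7]; the term [0]
brings it to the shape used in [gap_epsilon_step]. *)
Lemma sub_ln_ge_large (R : realType) (x : R) :
  0 < x -> (631 / 1000) * x + 0 <= x - ln x.
Proof.
have h : (expR (8%:R * (1 / 8)))^-1 <= 369 / 1000 :> R.
  by apply: inv_expR_le; clear; lra.
move=> /(sub_ln_ge h); clear; lra.
Qed.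

Lemma ln_ge_pade (R : realType) (k : nat) (y c x : R) :
  0 <= y -> c * (2 + y) <= k%:R * (2 * y) -> (1 + y) ^+ k <= x -> c <= ln x.
Proof.
move=> y0 cy yx.
have y1 : 0 < 1 + y by rewrite ltr_pwDl.
have yk : 0 < (1 + y) ^+ k by rewrite exprn_gt0.
apply: (@le_trans _ _ (ln ((1 + y) ^+ k))).
  rewrite lnXn// -[leRHS]mulr_natl.
  apply: (@le_trans _ _ (k%:R * (2 * y / (2 + y)))).
    by rewrite mulrA ler_pdivlMr// ltr_pwDl.
  by rewrite ler_wpM2l ?pade_le_ln1D.
by rewrite ler_ln ?posrE// (lt_le_trans yk).
Qed.

Lemma ln5_ge (R : realType) : 1607 / 1000 <= ln 5%:R :> R.
Proof.
(* [(1 + 529 / 5000)^16] is slightly below [5]. *)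
by apply: (@ln_ge_pade R 16 (529 / 5000)); lra.
Qed.

Lemma gap_epsilon_5_41 (R : realType) (n : nat) :
  (5 <= n <= 41)%N -> gap n (epsilon R n).
Proof.
move: n.
have H1 := @sub_ln_ge_small R; have H2 := @sub_ln_ge_large R.
have l5 := ln5_ge R.
(* One row for each [n] from [5] to [41]: a lower bound of [epsilon R n], then
a lower bound of [ln (n + 1)]. *)
row H1 (418 / 1000 : R) (1788 / 1000 : R).
row H1 (383 / 1000 : R) (1941 / 1000 : R).
row H1 (354 / 1000 : R) (2074 / 1000 : R).
row H1 (330 / 1000 : R) (2191 / 1000 : R).
row H1 (308 / 1000 : R) (2296 / 1000 : R).
row H1 (290 / 1000 : R) (2391 / 1000 : R).
row H1 (274 / 1000 : R) (2477 / 1000 : R).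
row H1 (259 / 1000 : R) (2557 / 1000 : R).
row H2 (248 / 1000 : R) (2631 / 1000 : R).
row H2 (237 / 1000 : R) (2699 / 1000 : R).
row H2 (227 / 1000 : R) (2763 / 1000 : R).
row H2 (217 / 1000 : R) (2823 / 1000 : R).
row H2 (209 / 1000 : R) (2880 / 1000 : R).
row H2 (201 / 1000 : R) (2934 / 1000 : R).
row H2 (194 / 1000 : R) (2985 / 1000 : R).
row H2 (188 / 1000 : R) (3033 / 1000 : R).
row H2 (182 / 1000 : R) (3079 / 1000 : R).
row H2 (176 / 1000 : R) (3123 / 1000 : R).
row H2 (171 / 1000 : R) (3165 / 1000 : R).
row H2 (166 / 1000 : R) (3205 / 1000 : R).
row H2 (161 / 1000 : R) (3244 / 1000 : R).
row H2 (157 / 1000 : R) (3281 / 1000 : R).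
row H2 (153 / 1000 : R) (3317 / 1000 : R).
row H2 (149 / 1000 : R) (3352 / 1000 : R).
row H2 (145 / 1000 : R) (3385 / 1000 : R).
row H2 (142 / 1000 : R) (3417 / 1000 : R).
row H2 (139 / 1000 : R) (3448 / 1000 : R).
row H2 (135 / 1000 : R) (3478 / 1000 : R).
row H2 (133 / 1000 : R) (3507 / 1000 : R).
row H2 (130 / 1000 : R) (3535 / 1000 : R).
row H2 (127 / 1000 : R) (3563 / 1000 : R).
row H2 (124 / 1000 : R) (3590 / 1000 : R).
row H2 (122 / 1000 : R) (3616 / 1000 : R).
row H2 (120 / 1000 : R) (3641 / 1000 : R).
row H2 (117 / 1000 : R) (3666 / 1000 : R).
row H2 (115 / 1000 : R) (3690 / 1000 : R).
row H2 (113 / 1000 : R) (3714 / 1000 : R).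
by move=> n; lia.
Qed.

Lemma ln_ln_sub_ge1 (R : realType) (n : nat) : (2 <= n)%N ->
  1 <= ln n%:R - ln (ln n%:R) :> R.
Proof.
move=> n2; have L0 : 0 < ln n%:R :> R by rewrite ln_gt0// ltr1n.
have : ln (1 + (ln n%:R - 1)) <= ln n%:R - 1 :> R by apply: le_ln1Dx; lra.
by rewrite addrC subrK; lra.
Qed.

Lemma epsilon_ge (R : realType) (n : nat) : (2 <= n)%N -> 2 <= epsilon R n * n%:R.
Proof.
move=> n2; rewrite /epsilon divfK ?pnatr_eq0//; last by case: n n2.
by have := ln_ln_sub_ge1 R n2; lra.
Qed.

Lemma gap_epsilon_2_4 (R : realType) (n : nat) :
  (2 <= n <= 4)%N -> gap n (epsilon R n).
Proof.
move=> /andP[n2 n4].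
have n0 : 0 < n%:R :> R by rewrite ltr0n; lia.
have w1 := ln_ln_sub_ge1 R n2.
have q0 : 0 <= 2 / n%:R :> R by rewrite divr_ge0// ltW.
apply: (gap_epsilon_of_le n2 q0 w1).
- by rewrite divfK ?gt_eqF// mulr1.
rewrite /gap; move: n2 n4; case: n {n0 w1 q0} => [|[|[|[|[|n]]]]] // _ _;
  rewrite [_.-1]/=; clear; lra.
Qed.

Lemma ln_ge42_ge (R : realType) (n : nat) :
  (42 <= n)%N -> 36 / 10 <= ln n%:R :> R.
Proof.
move=> n42.
apply: (@ln_ge_pade R 32 (12 / 100)); [lra|lra|].
apply: (@le_trans _ _ 42%:R); first by clear; lra.
by rewrite ler_nat.
Qed.

Lemma expR37_10_ge (R : realType) : 379 / 10 <= expR (37 / 10) :> R.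
Proof.
have -> : 37 / 10 = 10%:R * (37 / 100) :> R by field.
rewrite expRM_natl.
apply: (@le_trans _ _ ((1 + 37 / 100 + (37 / 100) ^+ 2 / 2) ^+ 10)); first by lra.
by rewrite lerXn2r ?nnegrE ?expR_ge0 ?expR_ge_quadratic//; lra.
Qed.

Lemma gap_epsilon_ge42 (R : realType) (n : nat) :
  (42 <= n)%N -> gap n (epsilon R n).
Proof.
move=> n42.
have n0 : 42 <= n%:R :> R by rewrite (ler_nat _ 42).
have L36 := ln_ge42_ge R n42.
rewrite /epsilon; set L := ln n%:R in L36 *.
have nL : expR L = n%:R by rewrite lnK ?posrE//; lra.
have L0 : 0 < L by lra.
have lnL : 5 / 4 <= ln L.
  apply: (@ln_ge_pade R 8 (17 / 100)); [by clear; lra|by clear; lra|].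
  by apply: (le_trans _ L36); clear; lra.
have wL := sub_ln_ge_large L0.
have eL : expR (ln L) = L by rewrite lnK ?posrE.
set w := L - ln L in wL *.
have w0 : 0 < w by lra.
(* This makes the exponent [X] below at most [45 / 100], hence
   [expR X <= 159 / 100]; as [w <= L - 5 / 4], it is a comparison of a quadratic
   polynomial in [L] with [n = expR L]. *)
have Xle : 2 * w * (1 + w) <= 45 / 100 * n%:R.
  have ww : 2 * w * (1 + w) <= 2 * (L - 5 / 4) * (L - 1 / 4).
    have wl : w <= L - 5 / 4 by rewrite /w; lra.
    by apply: ler_pM; lra.
  apply: (le_trans ww).
  have [Lle|Lge] := leP L (37 / 10).
    have : (37 / 10 - L) * (L + 37 / 10 - 3 / 2) >= 0 by apply: mulr_ge0; lra.
    lra.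
  pose v := L - 37 / 10.
  have v0 : 0 <= v by rewrite /v; lra.
  have : 379 / 10 * (1 + v + v ^+ 2 / 2) <= n%:R.
    rewrite -nL -[L](subrK (37 / 10)) -/v [v + _]addrC expRD.
    apply: ler_pM; [by clear; lra | | exact: expR37_10_ge | exact: expR_ge_quadratic].
    by clear -v0; nra.
  have -> : L = v + 37 / 10 by rewrite /v subrK.
  by nra.
pose d : R := 2 * w / n%:R.
have d0 : 0 < d by rewrite divr_gt0 ?mulr_gt0//; lra.
have dn : d * n%:R = 2 * w by rewrite /d divfK//; lra.
pose X := 2 * w * (1 + w) / (n%:R + w).
have eX : expR X <= 159 / 100.
  rewrite -[159 / 100]lnK ?posrE; last by lra.
  rewrite ler_expR.
  have h : 45 / 100 <= ln (159 / 100) :> R.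
    by apply: (@ln_ge_pade R 1 (59 / 100)); clear; lra.
  apply: (le_trans _ h).
  rewrite /X ler_pdivrMr; last by lra.
  lra.
(* [(n - 1) ln (1 + d) >= 2 w - X], and [expR w = n / L]. *)
have pw : (n%:R / L) ^+ 2 / (159 / 100) <= (1 + d) ^+ n.-1.
  apply: (@le_trans _ _ (expR (2%:R * w - X))).
    rewrite expRD expRN expRM_natl /w expRD expRN nL eL.
    by rewrite ler_wpM2l ?exprn_ge0 ?divr_ge0// ?lef_pV2 ?posrE ?expR_gt0//; lra.
  have -> : 2%:R * w - X = n.-1%:R * (2 * d / (2 + d)).
    have -> : n.-1%:R = n%:R - 1 :> R.
      by rewrite -[in RHS](@prednK n) ?(leq_trans _ n42)// -natr1 addrK.
    rewrite /X /d; field.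
    by apply/andP; split; lra.
  rewrite expRM_natl lerXn2r ?nnegrE ?expR_ge0//; first by lra.
  rewrite -[1 + d]lnK ?posrE; last by lra.
  by rewrite ler_expR pade_le_ln1D// ltW.
(* [2 * 631 / 1000] is greater than the square root of [159 / 100]. *)
have wL2 : 159 / 100 * L ^+ 2 <= (2 * w) ^+ 2.
  by nra.
rewrite /gap -/d.
have dd : (2 * w / n%:R) ^+ 2 * n%:R < d * (n.+1%:R * d + 1 / 2).
  rewrite -/d -natr1.
  nra.
apply: (@le_lt_trans _ _
  ((n%:R / L) ^+ 2 / (159 / 100) * ((2 * w / n%:R) ^+ 2 * n%:R))).
  have -> : (n%:R / L) ^+ 2 / (159 / 100) * ((2 * w / n%:R) ^+ 2 * n%:R) =
      n%:R * ((2 * w) ^+ 2 / (159 / 100 * L ^+ 2)).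
    by field; apply/andP; split; lra.
  rewrite ler_peMr//.
  have L2 : 0 < L ^+ 2 by rewrite exprn_gt0.
  by rewrite ler_pdivlMr ?mul1r//; lra.
apply: (le_lt_trans (y := (1 + d) ^+ n.-1 * ((2 * w / n%:R) ^+ 2 * n%:R))).
  by rewrite ler_wpM2r// mulr_ge0 ?sqr_ge0 ?ler0n.
by rewrite ltr_pM2l// exprn_gt0//; lra.
Qed.

Lemma gap_epsilon (R : realType) (n : nat) : (2 <= n)%N -> gap n (epsilon R n).
Proof.
move=> n2.
have [n4|n5] := leqP n 4; first by apply: gap_epsilon_2_4; rewrite n2.
have [n41|n42] := leqP n 41; first by apply: gap_epsilon_5_41; rewrite n5.
exact: gap_epsilon_ge42.
Qed.

(** * Newton's identities *)

Lemma dvdp_XnP (K : fieldType) (N : nat) (p : {poly K}) :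
  reflect (forall i, (i < N)%N -> p`_i = 0) ('X^N %| p).
Proof.
apply: (iffP idP) => [/dvdpP[q ->] i iN|p0]; first by rewrite coefMXn iN.
rewrite -[p](poly_take_drop N).
suff -> : take_poly N p = 0 by rewrite add0r dvdp_mulIr.
by apply/polyP => i; rewrite coef_take_poly coef0; case: ifP => // /p0.
Qed.

(** Newton's identities up to rank [N] between a sequence [s] of power sums, of
which [s 0] is ignored, and a sequence [c] of coefficients: they express that
[\sum_m c m X^m] and [exp (- \sum_(m > 0) s m X^m / m)] agree modulo
[X^(N + 1)]. *)
Definition newton (K : numFieldType) (N : nat) (s c : nat -> K) : Prop :=
  c 0%N = 1 /\ forall m, (m < N)%N ->
    c m.+1 *+ m.+1 = - \sum_(i < m.+1) s i.+1 * c (m - i)%N.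

Lemma newton_ext (K : numFieldType) (N : nat) (s s' c c' : nat -> K) :
  (forall m, (0 < m <= N)%N -> s m = s' m) ->
  (forall m, (m <= N)%N -> c m = c' m) ->
  newton N s c -> newton N s' c'.
Proof.
move=> ss' cc' [c0 H]; split=> [|m mN]; first by rewrite -cc'.
rewrite -cc'// H//; congr (- _); apply: eq_bigr => i _.
by rewrite ss' ?cc'//; have := ltn_ord i; lia.
Qed.

Lemma newton_exists (K : numFieldType) (s : nat -> K) :
  exists c, forall N, newton N s c.
Proof.
(* [v m] lists [c m, ..., c 0]. *)
pose fix v m := if m is k.+1 then
  - (\sum_(i < k.+1) s i.+1 * nth 0 (v k) i) / k.+1%:R :: v k else [:: 1].
exists (fun m => nth 0 (v m) 0) => N; split=> // m _.
rewrite /= -[LHS]mulr_natr divfK ?pnatr_eq0//; congr (- _).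
apply: eq_bigr => i _; congr (_ * _).
have: (i <= m)%N by rewrite -ltnS.
move: (i : nat) => {i}; elim: m => [|m IH] [|j]//; rewrite ltnS => jm.
by rewrite subSS -IH.
Qed.

Lemma newton_unique (K : numFieldType) (N : nat) (s c c' : nat -> K) :
  newton N s c -> newton N s c' -> forall m, (m <= N)%N -> c m = c' m.
Proof.
move=> [c0 H] [c0' H'] m; elim/ltn_ind: m => -[_ _|m IH mN]; first by rewrite c0.
apply: (mulIf (x := m.+1%:R)); rewrite ?pnatr_eq0// !mulr_natr H// H'//.
congr (- _); apply: eq_bigr => i _; rewrite IH//; have := ltn_ord i; lia.
Qed.

Lemma newton_sums_unique (K : numFieldType) (N : nat) (s s' c : nat -> K) :
  newton N s c -> newton N s' c -> forall m, (0 < m <= N)%N -> s m = s' m.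
Proof.
move=> [c0 H] [_ H'] m; elim/ltn_ind: m => -[//|m] IH /= mN.
have := H _ mN; rewrite H'// => /oppr_inj.
rewrite !big_ord_recr/= subnn c0 !mulr1.
rewrite (eq_bigr (fun i : 'I_m => s i.+1 * c (m - i)%N)).
  by move/addrI.
by move=> i _; rewrite IH//; have := ltn_ord i; lia.
Qed.

(** Newton's identities as the differential equation [C' + S C = 0] modulo
[X^N], where [S] has the coefficients [s 1, s 2, ...]. *)
Lemma newton_polyP (K : numFieldType) (N M : nat) (s c : nat -> K) : (N <= M)%N ->
  newton N s c <-> c 0%N = 1 /\
    'X^N %| (\poly_(i < M.+1) c i)^`() + \poly_(i < N) s i.+1 * \poly_(i < M.+1) c i.
Proof.
move=> NM.
have E m : (m < N)%N ->
    ((\poly_(i < M.+1) c i)^`() + \poly_(i < N) s i.+1 * \poly_(i < M.+1) c i)`_m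
    = c m.+1 *+ m.+1 + \sum_(i < m.+1) s i.+1 * c (m - i)%N.
  move=> mN; rewrite coefD coef_deriv coef_poly ltnS (leq_trans mN)//; congr (_ + _).
  rewrite coefM; apply: eq_bigr => i _; have im := ltn_ord i.
  have iN : (i < N)%N by exact: leq_ltn_trans mN.
  have mM : (m - i < M.+1)%N by rewrite ltnS (leq_trans (leq_subr _ _))// (leq_trans _ NM)// ltnW.
  by rewrite !coef_poly iN mM.
split=> -[c0 H]; split=> //.
- by apply/dvdp_XnP => m mN; rewrite E// H// addNr.
- move=> m mN; apply/eqP; rewrite -addr_eq0 -E//; apply/eqP.
  by move/dvdp_XnP : H; apply.
Qed.

(** The coefficients attached to [s] and to [- s] are those of series inverse to
each other: the product of the series has derivative zero. *)
Lemma newton_mul (K : numFieldType) (N M : nat) (s c d : nat -> K) : (N <= M)%N ->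
  newton N s c -> newton N (fun m => - s m) d ->
  forall m, (0 < m <= N)%N ->
    (\poly_(i < M.+1) c i * \poly_(i < M.+1) d i)`_m = 0.
Proof.
move=> NM /(newton_polyP _ _ NM)[_ C] /(newton_polyP _ _ NM)[_ D] [//|m] /= mN.
set A := \poly_(i < M.+1) c i in C *; set B := \poly_(i < M.+1) d i in D *.
set S := \poly_(i < N) s i.+1 in C.
have SN : \poly_(i < N) - s i.+1 = - S.
  by apply/polyP => i; rewrite coefN !coef_poly; case: ifP; rewrite ?oppr0.
have : 'X^N %| (A * B)^`().
  rewrite derivM [X in _ %| X](_ : _ = (A^`() + S * A) * B + A * (B^`() + (- S) * B)).
    by apply: dvdp_add; [exact: dvdp_mulr | rewrite -SN; exact: dvdp_mull].
  by ring.
move/dvdp_XnP => /(_ _ mN); rewrite coef_deriv -mulr_natr => /eqP.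
by rewrite mulf_eq0 pnatr_eq0 orbF => /eqP.
Qed.

(** The polynomial whose roots are the inverses of the nonzero elements of
[r]. *)
Definition recip_prod (K : fieldType) (r : seq K) : {poly K} :=
  \prod_(x <- r) (1 - x *: 'X).

Lemma size_recip_prod (K : fieldType) (r : seq K) :
  (size (recip_prod r) <= (size r).+1)%N.
Proof.
rewrite /recip_prod; elim: r => [|x r IH]; first by rewrite big_nil size_poly1.
rewrite big_cons (leq_trans (size_polyMleq _ _))//=.
have : (size (1 - x *: 'X : {poly K})%R <= 2)%N.
  rewrite (leq_trans (size_polyD _ _))// geq_max size_poly1 size_polyN.
  by rewrite (leq_trans (size_scale_leq _ _)) ?size_polyX.
by move=> /leq_add/(_ IH) h; rewrite -subn1 leq_subLR add1n -(add2n (size r).+1).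
Qed.

Lemma newton_recip_prod (K : numFieldType) (r : seq K) (N : nat) :
  newton N (fun m => \sum_(x <- r) x ^+ m) (fun m => (recip_prod r)`_m).
Proof.
have polyE (p : {poly K}) M : (size p <= M)%N -> \poly_(i < M) p`_i = p.
  move=> pM; apply/polyP => i; rewrite coef_poly; case: ltnP => // Mi.
  by rewrite nth_default// (leq_trans pM).
have NM : (N <= N + size r)%N by rewrite leq_addr.
apply/(newton_polyP _ _ NM).
rewrite polyE; last by rewrite (leq_trans (size_recip_prod r))// ltnS leq_addl.
split.
  rewrite -horner_coef0 /recip_prod horner_prod big1// => x _.
  by rewrite hornerD hornerN hornerZ hornerX mulr0 subr0 hornerC.
elim: r NM => [|x r IH] _.
  rewrite /recip_prod big_nil derivC add0r mulr1.
  by apply/dvdp_XnP => i iN; rewrite coef_poly iN big_nil.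
rewrite /recip_prod big_cons -/(recip_prod r).
set P := recip_prod r in IH *.
set S := \poly_(i < N) _ in IH.
set T := \poly_(i < N) x ^+ i.+1.
have -> : \poly_(i < N) (\sum_(y <- x :: r) y ^+ i.+1) = T + S.
  apply/polyP => i; rewrite coefD !coef_poly; case: ifP => _; last by rewrite addr0.
  by rewrite big_cons.
(* A truncated geometric series times [1 - x X]. *)
have Tx : T * (1 - x *: 'X) = x%:P - x ^+ N.+1 *: 'X^N.
  rewrite /T; elim: N {S IH T} => [|N IH].
    by rewrite poly_def big_ord0 mul0r expr1 expr0 alg_polyC subrr.
  rewrite poly_def big_ord_recr/= -(poly_def N (fun i => x ^+ i.+1)) mulrDl IH mulrBr mulr1.
  rewrite -scalerAl -scalerAr scalerA -exprSr -exprSr.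
  by rewrite addrA subrK.
rewrite derivM derivB derivC derivZ derivX sub0r.
rewrite [X in _ %| X](_ : _ = (1 - x *: 'X) * (P^`() + S * P)
   + (T * (1 - x *: 'X) - x%:P) * P); last first.
  by rewrite alg_polyC; ring.
apply: dvdp_add; first by apply: dvdp_mull; apply: IH; rewrite leq_addr.
apply: dvdp_mulr; rewrite Tx addrAC subrr sub0r -scaleNr -mul_polyC.
exact: dvdp_mulIr.
Qed.

Lemma coef_recip_prod (K : fieldType) (r : seq K) (m : nat) : (m <= size r)%N ->
  (recip_prod r)`_m = (\prod_(x <- r) ('X - x%:P))`_(size r - m).
Proof.
rewrite /recip_prod; elim: r m => [|x r IH] m.
  by rewrite leqn0 => /eqP->; rewrite !big_nil.
have sz : (\prod_(y <- r) ('X - y%:P))`_(size r).+1 = 0.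
  by rewrite nth_default// size_prod_XsubC.
have szr := size_recip_prod r.
rewrite /= !big_cons mulrBl mul1r mulrBl !coefB -scalerAl coefZ coefCM !coefXM => mr.
case: m mr => [|m] mr.
  by rewrite subn0 /= IH// subn0 sz !mulr0.
rewrite subSS /=; case: (ltnP m (size r)) => [mr'|rm].
  have e : (size r - m == 0)%N = false by apply/negbTE; rewrite -lt0n subn_gt0.
  by rewrite (IH m.+1)// (IH m (ltnW mr')) e subnS.
have -> : m = size r by lia.
rewrite subnn eqxx sub0r [X in _ - x * X]IH// subnn.
by rewrite [X in X - _]nth_default ?sub0r.
Qed.

(** * Estimates of power sums *)

Lemma cabs_sum (R : realType) (I : Type) (r : seq I) (P : pred I) (F : I -> R[i]) :
  cabs (\sum_(i <- r | P i) F i) <= \sum_(i <- r | P i) cabs (F i).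
Proof.
elim/big_rec2 : _ => [|i y1 y2 _ h]; first by rewrite ComplexField.Normc.normc0.
by apply: (le_trans (le_normcD _ _)); rewrite lerD2l.
Qed.

Lemma cabs_ge0 (R : realType) (x : R[i]) : 0 <= cabs x.
Proof. by case: x => a b /=; rewrite sqrtr_ge0. Qed.

Lemma cabsX (R : realType) (x : R[i]) (n : nat) : cabs (x ^+ n) = cabs x ^+ n.
Proof.
elim: n => [|n IH]; first by rewrite !expr0 ComplexField.Normc.normc1.
by rewrite !exprS ComplexField.Normc.normcM IH.
Qed.

Lemma newton_cabs_le (R : realType) (N : nat) (s c : nat -> R[i]) (m : nat) :
  newton N s c -> (m < N)%N ->
  cabs (c m.+1) *+ m.+1 <= \sum_(i < m.+1) cabs (s i.+1) * cabs (c (m - i)%N).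
Proof.
move=> [_ H] mN; rewrite -normcMn H// normcN.
apply: (le_trans (cabs_sum _ _ _)).
by apply: ler_sum => i _; rewrite ComplexField.Normc.normcM.
Qed.

(** Majorant method for Newton's recurrence. *)
Lemma newton_majorant (R : realType) (N : nat) (s c : nat -> R[i]) (b u : nat -> R) :
  newton N s c -> (forall m, (0 < m <= N)%N -> cabs (s m) <= b m) ->
  1 <= u 0%N ->
  (forall m, (m < N)%N -> \sum_(i < m.+1) b i.+1 * u (m - i)%N <= u m.+1 *+ m.+1) ->
  forall m, (m <= N)%N -> cabs (c m) <= u m.
Proof.
move=> nsc sb u0 bu m; elim/ltn_ind: m => -[_ _|m IH mN].
  by case: nsc => -> _; rewrite ComplexField.Normc.normc1.
rewrite -(@ler_pMn2r _ m.+1)//; apply: (le_trans (newton_cabs_le nsc mN)).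
apply: (le_trans _ (bu _ mN)); apply: ler_sum => i _; have im := ltn_ord i.
apply: ler_pM; rewrite ?cabs_ge0// ?sb ?IH//; lia.
Qed.

Lemma sum_coef_recip_prod (R : realType) (r : seq R[i]) : 1 \in r ->
  1 + \sum_(i < size r) (recip_prod r)`_i.+1 = 0.
Proof.
move=> r1.
apply: (@etrans _ _ (recip_prod r).[1]).
  rewrite (horner_coef_wide _ (size_recip_prod r)) big_ord_recl expr0 mulr1.
  have [-> _] := newton_recip_prod r 0; congr (_ + _).
  by apply: eq_bigr => i _; rewrite expr1n mulr1.
rewrite /recip_prod horner_prod; apply/eqP.
rewrite prodf_seq_eq0; apply/hasP; exists 1 => //=.
by rewrite hornerD hornerN hornerZ hornerX hornerC mulr1 subrr.
Qed.

Lemma sum_geom (R : realFieldType) (t : R) (n : nat) :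
  (1 - t) * \sum_(i < n) t ^+ i = 1 - t ^+ n.
Proof. by rewrite -[RHS]opprB subrX1 -mulNr opprB. Qed.

(** Estimate (b) for a family normalised to contain [1]. *)
Lemma power_sums_linear_contra (R : realType) (r : seq R[i]) (gamma : R) :
  0 < gamma -> 1 \in r ->
  (forall m, (0 < m <= size r)%N ->
    cabs (\sum_(x <- r) x ^+ m) <= gamma * m%:R * (1 + 2 * gamma)^-1 ^+ m) ->
  False.
Proof.
move=> g0 r1 H; set t := (1 + 2 * gamma)^-1 in H.
have t0 : 0 < t by rewrite invr_gt0; lra.
have tg : t * (1 + 2 * gamma) = 1 by rewrite mulVf//; lra.
pose u m := if m is k.+1 then gamma * (1 + gamma) ^+ k * t ^+ k.+1 else 1.
have u0 m : 0 <= u m by case: m => [|m] /=; rewrite ?mulr_ge0 ?exprn_ge0//; lra.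
have su m : \sum_(i < m.+1) t ^+ i.+1 * u (m - i)%N = (1 + gamma) ^+ m * t ^+ m.+1.
  elim: m => [|m IH]; first by rewrite big_ord_recl big_ord0 addr0 /= expr1 mulr1 expr0 mul1r.
  rewrite big_ord_recl /= (eq_bigr (fun i : 'I_m.+1 => t * (t ^+ i.+1 * u (m - i)%N))).
    rewrite -mulr_sumr IH !exprS; ring.
  by move=> i _; rewrite mulrA -exprS /bump /= add1n subSS.
have cu := newton_majorant (newton_recip_prod r (size r)) H (u := u) (lexx _).
have {}cu m : (m <= size r)%N -> cabs (recip_prod r)`_m <= u m.
  apply: cu => {}m mr.
  apply: (@le_trans _ _ (gamma * m.+1%:R * \sum_(i < m.+1) t ^+ i.+1 * u (m - i)%N)).
    rewrite mulr_sumr; apply: ler_sum => i _.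
    rewrite [leRHS]mulrA; apply: ler_wpM2r; first exact: u0.
    apply: ler_wpM2r; first by rewrite exprn_ge0// ltW.
    by rewrite ler_pM2l// ler_nat ltn_ord.
  rewrite su -[leRHS]mulr_natr /= le_eqVlt; apply/orP; left; apply/eqP; ring.
have := sum_coef_recip_prod r1.
move=> /eqP; rewrite addrC addr_eq0 => /eqP e.
have := cabs_sum (index_enum 'I_(size r)) xpredT (fun i => (recip_prod r)`_i.+1).
rewrite e normcN ComplexField.Normc.normc1; apply/negP; rewrite -ltNge.
apply: (@le_lt_trans _ _ (\sum_(i < size r) (gamma * t) * ((1 + gamma) * t) ^+ i)).
  apply: ler_sum => i _; apply: (le_trans (cu _ (ltn_ord i))).
  by rewrite /= exprMn exprS le_eqVlt; apply/orP; left; apply/eqP; ring.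
rewrite -mulr_sumr.
have -> : gamma * t = 1 - (1 + gamma) * t by lra.
by rewrite sum_geom ltrBlDr ltrDl exprn_gt0// mulr_gt0//; lra.
Qed.

Section ExprSmall.
(* The topology of [R] as a normed space, needed for [cvg_expr]. *)
Import numFieldNormedType.Exports.

Lemma exists_expr_lt (R : realType) (rho e : R) : 0 <= rho < 1 -> 0 < e ->
  exists N0, forall N, (N0 <= N)%N -> rho ^+ N < e.
Proof.
move=> /andP[r0 r1] e0.
have : ((fun n => rho ^+ n) @ \oo --> (0 : R))%classic.
  by apply: cvg_expr; rewrite ger0_norm.
move=> /cvgrPdist_lt /(_ _ e0) [N0 _ H]; exists N0 => N NN.
by have := H N NN; rewrite /= sub0r normrN ger0_norm// exprn_ge0.
Qed.

End ExprSmall.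

Lemma tail_sum_lt (R : realType) (t e : R) : 0 < t < 1 -> 0 < e ->
  exists N0, forall N, (N0 <= N)%N ->
    \sum_(i < N) (N + i).+2%:R * t ^+ (N + i).+1 < e.
Proof.
move=> /andP[t0 t1] e0.
(* With [rho = sqrt t], [(1 - rho) (k + 1) t^k <= rho^k]. *)
pose rho := Num.sqrt t.
have rho2 : rho ^+ 2 = t by rewrite sqr_sqrtr// ltW.
have r0 : 0 < rho by rewrite sqrtr_gt0.
have r1 : rho < 1 by rewrite -sqrtr1 ltr_sqrt.
have e1 : 0 < e * (1 - rho) ^+ 2 by rewrite mulr_gt0// exprn_gt0// subr_gt0.
have r01 : 0 <= rho < 1 by rewrite ltW.
have [N0 HN] := exists_expr_lt r01 e1; exists N0 => N /HN {}HN.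
have key k : (1 - rho) * (k.+1%:R * t ^+ k) <= rho ^+ k.
  have -> : (1 - rho) * (k.+1%:R * t ^+ k) = (1 - rho) * (k.+1%:R * rho ^+ k) * rho ^+ k.
    by rewrite -rho2 exprAC expr2 !mulrA.
  apply: ler_piMl; first by rewrite exprn_ge0// ltW.
  have : k.+1%:R * rho ^+ k <= \sum_(i < k.+1) rho ^+ i.
    rewrite -[k.+1 in leLHS]card_ord -sumr_const mulr_suml.
    apply: ler_sum => i _; rewrite mul1r ler_wiXn2l 1?ltW//.
    by rewrite -ltnS.
  rewrite -(ler_pM2l (x := 1 - rho)) ?subr_gt0// sum_geom => /le_trans; apply.
  by rewrite gerBl exprn_ge0// ltW.
rewrite -(ltr_pM2r (x := (1 - rho) ^+ 2)) ?exprn_gt0 ?subr_gt0//.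
apply: le_lt_trans HN.
apply: (@le_trans _ _ ((1 - rho) * \sum_(i < N) rho ^+ (N + i).+1)).
  rewrite mulrC expr2 -mulrA ler_pM2l ?subr_gt0// mulr_sumr.
  by apply: ler_sum => i _; exact: key.
rewrite (eq_bigr (fun i : 'I_N => rho ^+ N.+1 * rho ^+ i)); last first.
  by move=> i _; rewrite -exprD addSn.
rewrite -mulr_sumr mulrCA sum_geom exprS mulrAC.
apply: ler_piMl; first by rewrite exprn_ge0// ltW.
by rewrite mulr_ile1 ?subr_ge0 ?exprn_ile1 ?gerBl ?exprn_ge0// ltW.
Qed.

(** With [t = 1 / (1 + d)], a partial sum of [\sum_(m > n) (n / m) t^m] is at
most its first term with [n / (n + 1)] replaced by
[n (1 + d) / (d (n + 1) + 1 / 2)]. *)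
Lemma tail_telescope (R : realFieldType) (n k : nat) (d : R) :
  0 < d -> 1 / 2 <= d * n%:R ->
  \sum_(i < k) n%:R / (n + i).+1%:R * (1 + d)^-1 ^+ (n + i).+1 <=
  n%:R * (1 + d) / (d * n.+1%:R + 1 / 2) * (1 + d)^-1 ^+ n.+1.
Proof.
move=> d0 dn; set t := (1 + d)^-1.
have t0 : 0 < t by rewrite invr_gt0; lra.
have td : t * (1 + d) = 1 by rewrite mulVf//; lra.
(* [phi m - t phi (m + 1) >= n / m] for [m > n], so that the sum telescopes. *)
pose phi (m : nat) : R := n%:R * (1 + d) / (d * m%:R + 1 / 2).
have phi_ge0 m : 0 <= phi m.
  by rewrite divr_ge0 ?mulr_ge0 ?addr_ge0 ?mulr_ge0//; lra.
have step i : n%:R / (n + i).+1%:R <= phi (n + i).+1 - t * phi (n + i).+2.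
  have [m mE] : exists m, m = (n + i).+1 by exists (n + i).+1.
  have m0 : 0 < m%:R :> R by rewrite mE ltr0n.
  have mn : n%:R + 1 <= m%:R :> R by rewrite mE natr1 ler_nat ltnS leq_addr.
  rewrite -mE.
  have dm : d * n%:R + d <= d * m%:R.
    have := ler_wpM2l (ltW d0) mn; lra.
  have y0 : 0 < d * m%:R + 1 / 2 by lra.
  have y1 : 0 < d * m.+1%:R + 1 / 2 by rewrite -natr1 mulrDr mulr1; lra.
  have -> : phi m - t * phi m.+1 =
      n%:R * (d * (d * m%:R + d + 3 / 2)) / ((d * m%:R + 1 / 2) * (d * m.+1%:R + 1 / 2)).
    rewrite /phi /t -natr1; field.
    rewrite -natr1 mulrDr mulr1 in y1.
    by apply/and3P; split; lra.
  rewrite -mulrA ler_wpM2l// ler_pdivlMr ?mulr_gt0// mulrC ler_pdivrMr//.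
  by rewrite -(natr1 m); clear -dm dn; lra.
suff : \sum_(i < k) n%:R / (n + i).+1%:R * t ^+ (n + i).+1 <=
    phi n.+1 * t ^+ n.+1 - phi (n + k).+1 * t ^+ (n + k).+1.
  by move=> /le_trans; apply; rewrite gerBl mulr_ge0// exprn_ge0// ltW.
elim: k => [|k IH]; first by rewrite big_ord0 addn0 subrr.
rewrite big_ord_recr /=.
have := ler_wpM2r (exprn_ge0 (n + k).+1 (ltW t0)) (step k).
have -> : (phi (n + k).+1 - t * phi (n + k).+2) * t ^+ (n + k).+1 =
    phi (n + k).+1 * t ^+ (n + k).+1 - phi (n + k.+1).+1 * t ^+ (n + k.+1).+1.
  by rewrite addnS [t ^+ (n + k).+2]exprS; ring.
by move=> h; apply: (le_trans (lerD IH h)); rewrite addrA subrK.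
Qed.

Lemma newton_geom_le (R : realType) (s c : nat -> R[i]) (t : R) :
  0 <= t -> (forall N, newton N s c) ->
  (forall m, (0 < m)%N -> cabs (s m) <= t ^+ m) ->
  forall m, cabs (c m) <= t ^+ m.
Proof.
move=> t0 nsc st m.
apply: (@newton_majorant _ m s c (fun m => t ^+ m) (fun m => t ^+ m)) => //.
- by move=> k /andP[k0 _]; exact: st.
- move=> k _; rewrite (eq_bigr (fun=> t ^+ k.+1)).
    by rewrite sumr_const card_ord.
  move=> i _; rewrite -exprD addSn subnKC//; have := ltn_ord i; lia.
Qed.

(** Beyond the last nonzero power sum, only [n] of the [m] terms of Newton's
recurrence remain, whence the factor [n / m]. *)
Lemma newton_geom_tail_le (R : realType) (s c : nat -> R[i]) (n : nat) (t : R) :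
  0 <= t -> (forall N, newton N s c) ->
  (forall m, (0 < m <= n)%N -> cabs (s m) <= t ^+ m) ->
  (forall m, (n < m)%N -> s m = 0) ->
  forall m, (n <= m)%N -> cabs (c m.+1) <= n%:R / m.+1%:R * t ^+ m.+1.
Proof.
move=> t0 nsc st s0 m nm.
have ct : forall m, cabs (c m) <= t ^+ m.
  apply: (newton_geom_le t0 nsc) => k k0; have [kn|/s0->] := leqP k n.
    by apply: st; rewrite k0.
  by rewrite ComplexField.Normc.normc0 exprn_ge0.
rewrite mulrAC ler_pdivlMr ?ltr0n// mulr_natr.
apply: (le_trans (newton_cabs_le (nsc m.+1) (leqnn _))).
apply: (@le_trans _ _ (\sum_(i < m.+1 | (i < n)%N) t ^+ m.+1)).
  rewrite [leRHS]big_mkcond/=; apply: ler_sum => i _.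
  have im : (i <= m)%N by rewrite -ltnS.
  case: ltnP => [ilt|ni]; last first.
    by rewrite s0 ?ltnS// ComplexField.Normc.normc0 mul0r.
  have -> : t ^+ m.+1 = t ^+ i.+1 * t ^+ (m - i) by rewrite -exprD addSn subnKC.
  by apply: ler_pM; rewrite ?cabs_ge0// st.
rewrite (big_ord_narrow (leqW nm)) /= sumr_const card_ord mulr_natl//.
Qed.

(** Estimate (a) for a family normalised to contain [1]. *)
Lemma power_sums_geometric_contra (R : realType) (r : seq R[i]) (d : R) :
  0 < d -> 1 / 2 <= d * (size r)%:R -> gap (size r) d -> 1 \in r ->
  (forall m, (0 < m <= size r)%N ->
    cabs (\sum_(x <- r) x ^+ m) <= (1 + d)^-1 ^+ m) ->
  False.
Proof.
set n := size r => d0 dn gapd r1 H; set t := (1 + d)^-1 in H *.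
have n0 : (0 < n)%N by rewrite /n; case: (r) r1.
have t0 : 0 < t by rewrite invr_gt0; lra.
have td : t * (1 + d) = 1 by rewrite mulVf//; lra.
have t1 : t < 1 by nra.
pose s m : R[i] := if (m <= n)%N then \sum_(x <- r) x ^+ m else 0.
have sE m : (0 < m <= n)%N -> s m = \sum_(x <- r) x ^+ m.
  by rewrite /s => /andP[_ ->].
have st m : (0 < m)%N -> cabs (s m) <= t ^+ m.
  rewrite /s => m0; case: ifP => mn; first by apply: H; rewrite m0.
  by rewrite ComplexField.Normc.normc0 exprn_ge0// ltW.
have [c nc] := newton_exists s.
have [e ne] := newton_exists (fun m => - s m).
have ct := newton_geom_le (ltW t0) nc st.
have et : forall m, cabs (e m) <= t ^+ m.
  by apply: (newton_geom_le (ltW t0) ne) => m /st; rewrite normcN.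
have ctail := @newton_geom_tail_le _ s c n t (ltW t0) nc _ _.
have {}ctail m : (n <= m)%N -> cabs (c m.+1) <= n%:R / m.+1%:R * t ^+ m.+1.
  apply: ctail => {}m; first by case/andP => /st.
  by rewrite /s => nm; rewrite leqNgt nm.
have cP m : (m <= n)%N -> c m = (recip_prod r)`_m.
  apply: (newton_unique (nc n)).
  apply: (newton_ext _ _ (newton_recip_prod r n)) => // k kn.
  by rewrite sE.
have c_sum : \sum_(i < n.+1) c i = 0.
  rewrite big_ord_recl; have [-> _] := nc 0%N.
  rewrite -[RHS](sum_coef_recip_prod r1); congr (_ + _).
  by apply: eq_bigr => i _; exact: (cP i.+1 (ltn_ord i)).
pose M := n%:R * (1 + d) / (d * n.+1%:R + 1 / 2) * t ^+ n.+1 / (1 - t).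
(* The strict bound [M < 1] is the hypothesis [gap] rewritten. *)
have M1 : M < 1.
  have n0' : 0 < n%:R :> R by rewrite ltr0n.
  have -> : M = n%:R / ((1 + d) ^+ n.-1 * (d * (n.+1%:R * d + 1 / 2))).
    have -> : M = n%:R * (1 + d) / (d * n.+1%:R + 1 / 2) *
        (t * t * ((1 + d) ^+ n.-1)^-1) / (1 - t).
      by rewrite /M -exprVn -/t -[t * t * _]mulrA -!exprS prednK.
    have P0 : (1 + d) ^+ n.-1 != 0 by rewrite expf_neq0//; lra.
    have n1 : 0 < n.+1%:R :> R by rewrite ltr0n.
    have dn1 : 0 < d * n.+1%:R by rewrite mulr_gt0.
    rewrite /t; move: P0 n1 dn1; move: (_ ^+ n.-1) (n.+1%:R : R) => P a P0 n1 dn1.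
    by field; rewrite P0; clear -d0 dn1 n1; repeat (apply/andP; split); lra.
  rewrite /gap in gapd; have D0 := lt_trans n0' gapd.
  by rewrite (ltr_pdivrMr _ _ D0) [ltRHS]mul1r.
have [N0 HN] := @tail_sum_lt R t (1 - M) ltac:(lra) ltac:(lra).
pose N := (n + N0)%N.
(* The partial sums of the two series are values at [1]; the product of the two
   truncations is [1] up to terms of degree greater than [N], whose contribution
   tends to [0]. *)
pose A := \poly_(i < N.+1) c i; pose B := \poly_(i < N.+1) e i.
have A1 : cabs A.[1] <= n%:R * (1 + d) / (d * n.+1%:R + 1 / 2) * t ^+ n.+1.
  have -> : A.[1] = \sum_(i < N0) c (n + i).+1.
    rewrite horner_poly (eq_bigr (fun i : 'I_N.+1 => c i)).
      by rewrite /N -addSn big_split_ord /= c_sum add0r.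
    by move=> i _; rewrite expr1n mulr1.
  apply: (le_trans (cabs_sum _ _ _)).
  apply: (le_trans _ (tail_telescope N0 d0 dn)).
  by apply: ler_sum => i _; apply: ctail; rewrite leq_addr.
have B1 : cabs B.[1] <= (1 - t)^-1.
  rewrite horner_poly; apply: (le_trans (cabs_sum _ _ _)).
  rewrite -[leRHS]mul1r ler_pdivlMr ?subr_gt0// mulrC.
  apply: (@le_trans _ _ ((1 - t) * \sum_(i < N.+1) t ^+ i)).
    rewrite ler_pM2l ?subr_gt0//; apply: ler_sum => i _.
    by rewrite expr1n mulr1.
  by rewrite sum_geom gerBl exprn_ge0// ltW.
have AB1 : (A * B).[1] = 1 + \sum_(i < N) (A * B)`_(N + i).+1.
  have sAB : (size (A * B)%R <= N.+1 + N)%N.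
    rewrite (leq_trans (size_polyMleq _ _))//.
    have sA : (size A <= N.+1)%N by exact: size_poly.
    have sB : (size B <= N.+1)%N by exact: size_poly.
    by have := leq_add sA sB; rewrite -subn1 leq_subLR add1n addnS.
  rewrite (horner_coef_wide _ sAB) big_split_ord /=; congr (_ + _).
    rewrite big_ord_recl big1 ?addr0.
      rewrite expr0 mulr1 coef0M !coef_poly /=.
      by have [-> _] := nc 0%N; have [-> _] := ne 0%N; rewrite mulr1.
    by move=> i _; rewrite (newton_mul (leqnn N) (nc N) (ne N)) ?mul0r ?(ltn_ord i).
  by apply: eq_bigr => i _; rewrite expr1n mulr1.
have ABt j : cabs (A * B)`_j <= j.+1%:R * t ^+ j.
  rewrite coefM; apply: (le_trans (cabs_sum _ _ _)).
  have -> : j.+1%:R * t ^+ j = \sum_(i < j.+1) t ^+ j.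
    by rewrite sumr_const card_ord mulr_natl.
  apply: ler_sum => i _; rewrite ComplexField.Normc.normcM.
  have ij : (i <= j)%N by rewrite -ltnS.
  have -> : t ^+ j = t ^+ i * t ^+ (j - i) by rewrite -exprD subnKC.
  have pt (f : nat -> R[i]) k : (forall m, cabs (f m) <= t ^+ m) ->
      cabs (\poly_(i < N.+1) f i)`_k <= t ^+ k.
    move=> ft; rewrite coef_poly; case: ifP => // _.
    by rewrite ComplexField.Normc.normc0 exprn_ge0// ltW.
  by apply: ler_pM; rewrite ?cabs_ge0// pt.
have : 1 <= M + \sum_(i < N) (N + i).+2%:R * t ^+ (N + i).+1.
  rewrite -[leLHS](@ComplexField.Normc.normc1 R).
  have -> : 1 = A.[1] * B.[1] - \sum_(i < N) (A * B)`_(N + i).+1.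
    by rewrite -hornerM AB1 addrK.
  apply: (le_trans (le_normcD _ _)); rewrite normcN; apply: lerD.
    rewrite ComplexField.Normc.normcM.
    by apply: ler_pM; rewrite ?cabs_ge0.
  apply: (le_trans (cabs_sum _ _ _)); apply: ler_sum => i _; exact: ABt.
have NN : (N0 <= N)%N by rewrite leq_addl.
by have := HN _ NN; lra.
Qed.

(** * The complex exponential *)

Lemma cexpD (R : realType) (z w : R[i]) : cexp (z + w) = cexp z * cexp w.
Proof.
case: z w => [x y] [x' y'] /=; rewrite expRD cosD sinD.
by apply/eqP; rewrite eq_complex /=; apply/andP; split; apply/eqP; ring.
Qed.

Lemma cexp0 (R : realType) : cexp (0 : R[i]) = 1.
Proof. by rewrite /= expR0 cos0 sin0 mulr1 mulr0. Qed.

Lemma cexpM_natr (R : realType) (z : R[i]) (m : nat) : cexp (z * m%:R) = cexp z ^+ m.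
Proof.
elim: m => [|m IH]; first by rewrite mulr0 expr0 cexp0.
by rewrite -natr1 mulrDr mulr1 cexpD IH exprSr.
Qed.

Lemma xexpME (R : realType) (lam : xcomplex R) (m : nat) :
  xexpM lam m = xexp lam ^+ m.
Proof. by case: lam => [z|] /=; [exact: cexpM_natr | rewrite expr0n]. Qed.

Lemma cabs_cexp (R : realType) (z : R[i]) : cabs (cexp z) = expR (complex.Re z).
Proof.
case: z => x y /=; rewrite !exprMn -mulrDr cos2Dsin2 mulr1 sqrtr_sqr.
by rewrite ger0_norm ?expR_ge0.
Qed.

Lemma cexp_neq0 (R : realType) (z : R[i]) : cexp z != 0.
Proof.
apply/eqP => z0; have := cabs_cexp z; rewrite z0 ComplexField.Normc.normc0.
by move=> /esym/eqP; rewrite expR_eq0.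
Qed.

Lemma polar_angle (R : realType) (a b : R) : a ^+ 2 + b ^+ 2 = 1 ->
  exists y, cos y = a /\ sin y = b.
Proof.
move=> ab; have a1 : -1 <= a <= 1 by apply/andP; split; nra.
have ca : cos (acos a) = a by rewrite acosK// in_itv.
have sa : sin (acos a) = `|b| by rewrite sin_acos// -ab addrAC subrr add0r sqrtr_sqr.
have [b0|b0] := leP 0 b.
  by exists (acos a); rewrite ca sa ger0_norm.
by exists (- acos a); rewrite cosN sinN ca sa ltr0_norm// opprK.
Qed.

Lemma cexp_surj (R : realType) (z : R[i]) : z != 0 -> exists w, cexp w = z.
Proof.
move=> z0; set r := cabs z.
have r0 : 0 < r.
  rewrite lt_neqAle eq_sym; apply/andP; split.
    by apply: contra z0 => /eqP/ComplexField.Normc.eq0_normc ->.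
  by rewrite /r; case: (z) => a b; rewrite sqrtr_ge0.
have r2 : r ^+ 2 = complex.Re z ^+ 2 + complex.Im z ^+ 2.
  by rewrite /r; case: (z) => a b /=; rewrite sqr_sqrtr// addr_ge0 ?sqr_ge0.
have [|y [cy sy]] := @polar_angle R (complex.Re z / r) (complex.Im z / r).
  by rewrite !exprMn -mulrDl -r2 -exprMn divff ?expr1n// gt_eqF.
exists (ln r +i* y); rewrite /= cy sy lnK ?posrE//.
rewrite !(mulrC r) !divfK ?gt_eqF//.
by case: (z).
Qed.

Lemma sin_cos_periodz (R : realType) (y : R) (j : int) :
  cos (y + 2 * pi * j%:~R) = cos y /\ sin (y + 2 * pi * j%:~R) = sin y.
Proof.
have P (f : R -> R) : periodic f (pi *+ 2) -> f (y + 2 * pi * j%:~R) = f y.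
  move=> pf; rewrite mulr_natl; case: j => n.
    by rewrite -pmulrn mulr_natr periodicn.
  rewrite NegzE mulrNz mulrN -pmulrn mulr_natr.
  by rewrite -[LHS](periodicn pf n.+1) subrK.
by split; apply: P; [exact: cosD2pi | exact: sinD2pi].
Qed.

Lemma cos_eq1 (R : realType) (y : R) : cos y = 1 -> exists j : int, y = 2 * pi * j%:~R.
Proof.
move=> cy; have pi0 : 0 < 2 * pi :> R by rewrite mulr_gt0 ?pi_gt0.
(* Reduce [y] to [b] in [0, 2 pi[, where [cos b = 1 - 2 sin (b / 2)^2]. *)
pose j := Num.floor (y / (2 * pi)); exists j.
pose b := y - 2 * pi * j%:~R.
have cb : cos b = 1.
  by rewrite -cy -[in RHS](subrK (2 * pi * j%:~R) y) (sin_cos_periodz _ j).1.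
have b0 : 0 <= b.
  have := floor_le (y / (2 * pi)); rewrite ler_pdivlMr// => h.
  by rewrite subr_ge0 mulrC.
have b2 : b < 2 * pi.
  have := floorD1_gt (y / (2 * pi)); rewrite ltr_pdivrMr// => h.
  rewrite /b ltrBlDl; move: h; rewrite intrD mulrDl mul1r mulrC; exact.
have s0 : sin (b / 2) = 0.
  have := cosD (b / 2) (b / 2); rewrite -splitr cb => e.
  have e1 := cos2Dsin2 (b / 2).
  have : sin (b / 2) ^+ 2 = 0 by rewrite expr2 in e1 *; nra.
  by move=> /eqP; rewrite sqrf_eq0 => /eqP.
have [b1|b1] := ltP 0 b; last first.
  by apply/eqP; rewrite -subr_eq0 -/b eq_le b1.
have : 0 < sin (b / 2) by apply: sin_gt0_pi; lra.
by rewrite s0 ltxx.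
Qed.

Lemma cexp_inj (R : realType) (z w : R[i]) : cexp z = cexp w ->
  exists j : int, z = w + (0 +i* (2 * pi)) * j%:~R.
Proof.
move=> e; have er : complex.Re z = complex.Re w.
  by apply: expR_inj; rewrite -!cabs_cexp e.
have := f_equal (fun u => u * cexp (- w)) e; rewrite -!cexpD subrr cexp0.
case: z w er {e} => [x y] [x' y'] /= -> ; rewrite subrr expR0 mul1r => -[/cos_eq1[j yj] _].
exists j.
have jE : (j%:~R : R[i]) = (j%:~R)%:C by rewrite rmorph_int.
rewrite jE; apply/eqP; rewrite eq_complex /=.
rewrite !mulr0 !mul0r !subr0 !addr0 eqxx /=.
by rewrite add0r -yj addrC subrK.
Qed.

Lemma xexp_inj (R : realType) (lam lam' : xcomplex R) :
  xexp lam = xexp lam' -> eq_mod_2pii lam lam'.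
Proof.
case: lam lam' => [z|] [w|] //= e; first exact: cexp_inj.
- by have := cexp_neq0 z; rewrite e eqxx.
- by have := cexp_neq0 w; rewrite -e eqxx.
Qed.

Lemma xexp_surj (R : realType) (l : R[i]) : exists lam : xcomplex R, xexp lam = l.
Proof.
have [->|/cexp_surj[w <-]] := eqVneq l 0; first by exists None.
by exists (Some w).
Qed.

(** The passage from [|exp(lambda)| <= k a] to real parts; for [a = 0] both sides
are [-oo]. *)
Lemma xRe_le (R : realType) (lam : xcomplex R) (a k e : R) :
  0 <= a -> ln k <= e -> cabs (xexp lam) <= k * a ->
  (-oo <= xRe lam <= lne a%:E + e%:E)%E.
Proof.
move=> a0 ke; rewrite leNye andTb; case: lam => [z|]; last by rewrite leNye.
rewrite /xexp /xRe. rewrite cabs_cexp => h.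
have ka : 0 < k * a by apply: lt_le_trans h; exact: expR_gt0.
have a1 : 0 < a by rewrite lt_neqAle a0 andbT; apply/eqP => a00; rewrite -a00 mulr0 ltxx in ka.
have k0 : 0 < k by rewrite pmulr_lgt0 in ka.
rewrite lne_EFin// -EFinD lee_fin -[complex.Re z]expRK.
apply: (@le_trans _ _ (ln (k * a))); first by rewrite ler_ln ?posrE ?expR_gt0.
by rewrite lnM ?posrE// addrC lerD2l.
Qed.

(** * Families with given power sums *)

Lemma power_sums_exist (K : numClosedFieldType) (n : nat) (p : nat -> K) :
  exists l : 'I_n -> K, forall m, (0 < m <= n)%N -> \sum_(k < n) l k ^+ m = p m.
Proof.
have [c nc] := newton_exists p.
(* The monic polynomial with the coefficients given by Newton's identities. *)
pose Q := \poly_(i < n.+1) c (n - i)%N.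
have Qn : Q`_n = 1 by rewrite coef_poly ltnSn subnn; case: (nc 0%N).
have szQ : size Q = n.+1.
  by rewrite size_poly_eq// subnn; have [-> _] := nc 0%N; rewrite oner_neq0.
have [r Qr] := closed_field_poly_normal Q.
have lQ : lead_coef Q = 1 by rewrite /lead_coef szQ.
rewrite lQ scale1r in Qr.
have szr : size r = n by move: szQ; rewrite Qr size_prod_XsubC => -[].
exists (fun k => r`_k) => m mn.
have -> : \sum_(k < n) r`_k ^+ m = \sum_(x <- r) x ^+ m.
  by rewrite (big_nth 0) szr big_mkord.
apply: (newton_sums_unique (newton_recip_prod r n) _ mn).
apply: (newton_ext _ _ (nc n)) => // k kn.
by rewrite coef_recip_prod szr// -Qr coef_poly ltnS leq_subr subKn.
Qed.

Lemma power_sums_unique (K : numFieldType) (n : nat) (l l' : 'I_n -> K) :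
  (forall m, (0 < m <= n)%N -> \sum_(k < n) l k ^+ m = \sum_(k < n) l' k ^+ m) ->
  exists s : 'S_n, forall k, l k = l' (s k).
Proof.
move=> H.
have sumE (f : 'I_n -> K) m :
    \sum_(x <- [tuple f k | k < n]) x ^+ m = \sum_(k < n) f k ^+ m.
  by rewrite big_map big_enum.
have : perm_eq [tuple l k | k < n] [tuple l' k | k < n].
  apply: prod_XsubC_eq; apply/polyP => i.
  set r := [tuple l k | k < n]; set r' := [tuple l' k | k < n].
  have [ni|] := ltnP n i.
    by rewrite !nth_default// size_prod_XsubC size_tuple.
  move=> iLn; rewrite -(subKn iLn).
  have coefE (t : n.-tuple K) m : (m <= n)%N ->
      (\prod_(x <- t) ('X - x%:P))`_(n - m) = (recip_prod t)`_m.
    by move=> mn; rewrite coef_recip_prod size_tuple.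
  rewrite !coefE ?leq_subr//.
  apply: (newton_unique (newton_recip_prod r n)); last exact: leq_subr.
  apply: (newton_ext _ _ (newton_recip_prod r' n)) => // m mn.
  by rewrite !sumE H.
move=> /tuple_permP[s es]; exists s => k.
have := f_equal (fun t : seq K => nth 0 t k) es.
by rewrite !nth_mktuple tnth_mktuple.
Qed.

(** Division of a family by one of its elements that exceeds [k a]. *)
Lemma power_sums_normalize (R : realType) (n : nat) (l : 'I_n -> R[i])
    (b : nat -> R) (a k : R) (k0 : 'I_n) :
  0 <= a -> 0 < k -> k * a < cabs (l k0) ->
  (forall m, 0 <= b m) ->
  (forall m, (0 < m <= n)%N -> cabs (\sum_(j < n) l j ^+ m) <= b m * a ^+ m) ->
  exists r : seq R[i], [/\ size r = n, 1 \in r &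
    forall m, (0 < m <= size r)%N ->
      cabs (\sum_(x <- r) x ^+ m) <= b m * k^-1 ^+ m].
Proof.
move=> a0 kp ka b0 H; set x := l k0 in ka.
have x0 : 0 < cabs x by apply: le_lt_trans ka; rewrite mulr_ge0// ltW.
have xN0 : x != 0.
  by apply/eqP => e; rewrite e ComplexField.Normc.normc0 ltxx in x0.
exists [seq l j / x | j <- enum 'I_n]; split.
- by rewrite size_map size_enum_ord.
- by apply/mapP; exists k0; rewrite ?mem_enum// divff.
move=> m; rewrite size_map size_enum_ord => mn.
rewrite big_map big_enum /= (eq_bigr (fun j => l j ^+ m / x ^+ m)); last first.
  by move=> j _; rewrite expr_div_n.
rewrite -mulr_suml ComplexField.Normc.normcM ComplexField.Normc.normcV cabsX.
rewrite ler_pdivrMr ?exprn_gt0//; apply: (le_trans (H _ mn)).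
have ax : a <= k^-1 * cabs x by rewrite ler_pdivlMl// ltW.
rewrite -mulrA ler_wpM2l// -exprMn lerXn2r ?nnegrE//.
exact: le_trans ax.
Qed.

Lemma cabs_power_sum_le (R : realType) (n : nat) (g0 gm : R[i]) (B : R) :
  (0 < n)%N -> g0 != 0 -> cabs gm <= cabs g0 / n%:R * B ->
  cabs (n%:R / g0 * gm) <= B.
Proof.
move=> n0 g00; have n0' : 0 < n%:R :> R by rewrite ltr0n.
have g0' : 0 < cabs g0.
  rewrite lt_neqAle cabs_ge0 andbT eq_sym; apply: contra g00.
  by move=> /eqP/ComplexField.Normc.eq0_normc ->.
rewrite !ComplexField.Normc.normcM ComplexField.Normc.normcV.
have -> : cabs (n%:R : R[i]) = n%:R by rewrite normcMn ComplexField.Normc.normc1.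
move=> h; have -> : B = n%:R / cabs g0 * (cabs g0 / n%:R * B).
  by field; rewrite !gt_eqF.
by rewrite ler_wpM2l// divr_ge0 ?ltW.
Qed.

Lemma exp_sum_systemP (R : realType) (n : nat) (g : nat -> R[i]) (mu : R[i])
    (Lam : 'I_n -> xcomplex R) : (0 < n)%N -> g 0%N != 0 ->
  (mu != 0 /\ exp_sum_system g mu Lam) <->
  (mu = g 0%N /\ power_sum_system g (fun k => xexp (Lam k))).
Proof.
move=> n0 g0; have nN0 : n%:R != 0 :> R[i] by rewrite pnatr_eq0 -lt0n.
have sumE m : \sum_(k < n) xexpM (Lam k) m = \sum_(k < n) xexp (Lam k) ^+ m.
  by apply: eq_bigr => k _; rewrite xexpME.
have sum0 : \sum_(k < n) xexpM (Lam k) 0 = n%:R.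
  by rewrite sumE (eq_bigr (fun=> 1))// sumr_const card_ord.
split=> [[mu0 H]|[-> H]].
  have muE : mu = g 0%N by rewrite -(H 0%N (leq0n _)) sum0 divfK.
  split=> // m /andP[_ mn]; rewrite -(H m mn) sumE -muE.
  by rewrite mulrA mulrA divfK// divff// mul1r.
split=> // -[_|m mn]; first by rewrite sum0 divfK.
by rewrite sumE (H m.+1) ?mn// mulrA mulrA divfK// divff// mul1r.
Qed.

Unset Implicit Arguments.

Theorem theorem5 (R : realType) (n : nat) (g : nat -> R[i])
    (hn : (1 <= n)%N) (hg : g 0%N != 0) :
  (* existence *)
  (exists (mu : R[i]) (Lam : 'I_n -> xcomplex R),
     mu != 0 /\ exp_sum_system g mu Lam) /\
  (* uniqueness *)
  (forall (mu mu' : R[i]) (Lam Lam' : 'I_n -> xcomplex R),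
     mu != 0 -> exp_sum_system g mu Lam ->
     mu' != 0 -> exp_sum_system g mu' Lam' ->
     mu = mu' /\
     exists s : 'S_n, forall k : 'I_n, eq_mod_2pii (Lam k) (Lam' (s k))) /\
  (* the system for l_1, ..., l_n has a solution, unique up to ordering *)
  (exists l : 'I_n -> R[i], power_sum_system g l) /\
  (forall l l' : 'I_n -> R[i],
     power_sum_system g l -> power_sum_system g l' ->
     exists s : 'S_n, forall k : 'I_n, l k = l' (s k)) /\
  (* determination of mu and of the lambda_k *)
  (forall (mu : R[i]) (Lam : 'I_n -> xcomplex R),
     (mu != 0 /\ exp_sum_system g mu Lam) <->
     (mu = g 0%N /\
      exists l : 'I_n -> R[i],
        power_sum_system g l /\ forall k : 'I_n, xexp (Lam k) = l k)) /\
  (* (a) *)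
  ((2 <= n)%N -> forall a : R, 0 <= a ->
     (forall m : nat, (1 <= m <= n)%N ->
        cabs (g m) <= cabs (g 0%N) / n%:R * a ^+ m) ->
     forall l : 'I_n -> R[i], power_sum_system g l ->
       \big[Num.max/0]_(k < n) cabs (l k) <= (1 + epsilon R n) * a /\
       forall Lam : 'I_n -> xcomplex R,
         (forall k : 'I_n, xexp (Lam k) = l k) ->
         forall k : 'I_n,
           (-oo <= xRe (Lam k) <= lne a%:E + (epsilon R n)%:E)%E) /\
  (* (b) *)
  (forall gamma a : R, 0 < gamma -> 0 <= a ->
     (forall m : nat, (1 <= m <= n)%N ->
        cabs (g m) <= cabs (g 0%N) / n%:R * (gamma * m%:R * a ^+ m)) ->
     forall l : 'I_n -> R[i], power_sum_system g l ->
       \big[Num.max/0]_(k < n) cabs (l k) <= (1 + 2 * gamma) * a /\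
       forall Lam : 'I_n -> xcomplex R,
         (forall k : 'I_n, xexp (Lam k) = l k) ->
         forall k : 'I_n,
           (-oo <= xRe (Lam k) <= lne a%:E + (ln (1 + 2 * gamma))%:E)%E).
Proof.
have sol : exists l : 'I_n -> R[i], power_sum_system g l.
  by have [l Hl] := power_sums_exist n (fun m => n%:R / g 0%N * g m); exists l.
have uniq (l l' : 'I_n -> R[i]) : power_sum_system g l -> power_sum_system g l' ->
    exists s : 'S_n, forall k : 'I_n, l k = l' (s k).
  by move=> H H'; apply: power_sums_unique => m mn; rewrite H ?H'.
have bound (l : 'I_n -> R[i]) (k a e : R) : 0 <= a -> 0 < k -> ln k <= e ->
    (forall j, cabs (l j) <= k * a) ->
    \big[Num.max/0]_(j < n) cabs (l j) <= k * a /\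
    forall Lam : 'I_n -> xcomplex R, (forall j, xexp (Lam j) = l j) ->
      forall j, (-oo <= xRe (Lam j) <= lne a%:E + e%:E)%E.
  move=> a0 k0 ke H; split=> [|Lam LamE j]; last first.
    by apply: (xRe_le a0 ke); rewrite LamE.
  by apply: bigmax_le => //; rewrite mulr_ge0// ltW.
split; [|split; [|split; [|split; [|split; [|split]]]]] => //.
- have [l Hl] := sol; have [Lam LamE] := choice (fun k => xexp_surj (l k)).
  exists (g 0%N), Lam; apply/exp_sum_systemP => //; split=> // m mn.
  by rewrite -Hl//; apply: eq_bigr => k _; rewrite LamE.
- move=> mu mu' Lam Lam' mu0 H mu0' H'.
  have [-> HL] := (exp_sum_systemP mu Lam hn hg).1 (conj mu0 H).
  have [-> HL'] := (exp_sum_systemP mu' Lam' hn hg).1 (conj mu0' H').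
  split=> //; have [s Hs] := uniq _ _ HL HL'; exists s => k.
  exact: xexp_inj.
- move=> mu Lam; rewrite exp_sum_systemP//; split=> -[-> H]; split=> //.
    by exists (fun k => xexp (Lam k)).
  have [l [Hl E]] := H => m mn; rewrite -Hl//.
  by apply: eq_bigr => k _; rewrite E.
- move=> n2 a a0 ga l Hl; have e2 := epsilon_ge R n2.
  have en : 0 < n%:R :> R by rewrite ltr0n.
  have e0 : 0 < epsilon R n by rewrite -(pmulr_lgt0 _ en); lra.
  apply: bound => //; [by lra | by apply: le_ln1Dx; lra |].
  move=> j; rewrite leNgt; apply/negP => lt_j.
  have [||||r [szr r1 Hr]] := @power_sums_normalize R n l (fun=> 1) a _ j _ _ lt_j.
  + by [].
  + by lra.
  + by [].
  + by move=> m mn; rewrite Hl// mul1r; apply: cabs_power_sum_le => //; exact: ga.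
  apply: (@power_sums_geometric_contra R r (epsilon R n)) => //; rewrite ?szr;
    [by lra | exact: gap_epsilon |].
  by move=> m mn; have := Hr m; rewrite szr mul1r; exact.
- move=> gamma a g0 a0 ga l Hl.
  apply: bound => //; first by lra.
  move=> j; rewrite leNgt; apply/negP => lt_j.
  have [||||r [szr r1 Hr]] :=
    @power_sums_normalize R n l (fun m => gamma * m%:R) a _ j _ _ lt_j.
  + by [].
  + by lra.
  + by move=> m; rewrite mulr_ge0// ltW.
  + by move=> m mn; rewrite Hl//; apply: cabs_power_sum_le => //; exact: ga.
  exact: (power_sums_linear_contra g0 r1 Hr).
Qed.
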